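(* Let $T$ be a moon polyomino with $s$ rows and $t$ columns, let $\mathbf{m}=(m_1,\dots,m_s)$ and $\mathbf{n}=(n_1,\dots,n_t)$ be tuples of nonnegative integers, and let $A\subseteq[t]$, $B\subseteq[s]$. Then $$\sum_{F\in\mathcal{N}^c(T,\mathbf{m};A)}p^{\mathrm{ne}_2(F)}q^{\mathrm{se}_2(F)}=\prod_{d=1}^s{h_d\brack m_d}_{p,q},\qquad \sum_{F\in\mathcal{N}^r(T,\mathbf{n};B)}p^{\mathrm{ne}_2(F)}q^{\mathrm{se}_2(F)}=\prod_{d=1}^t{h'_d\brack n_d}_{p,q},$$ where $h_d$ and $h'_d$ are defined below.
   Context: A moon polyomino is a finite set of unit cells of the integer grid that is convex (every row and every column of cells is a contiguous segment) and intersection-free (for any two rows, the set of horizontal positions of one contains that of the other; equivalently for columns). Rows are labelled $R_1,\dots,R_s$ from top to bottom, columns $C_1,\dots,C_t$ from left to right; $r_i$ is the number of cells of $R_i$ and $c_j$ the number of cells of $C_j$. These sequences are unimodal; let $i_0$ be the largest index with $r_{i_0}=\max_i r_i$ and $j_0$ the largest index with $c_{j_0}=\max_j c_j$. $Up(T)=\{R_i:i\le i_0\}$, $Low(T)=\{R_i:i>i_0\}$, $Left(T)=\{C_j:j\le j_0\}$, $Right(T)=\{C_j:j>j_0\}$. Total order on rows: $R_i\prec R_j$ iff $r_i<r_j$, or $r_i=r_j$ and $R_i\in Up(T)$, $R_j\in Low(T)$, or $r_i=r_j$, both in $Up(T)$ and $i<j$, or $r_i=r_j$, both in $Low(T)$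 and $i>j$. Total order on columns: $C_i\prec C_j$ iff $c_i<c_j$, or $c_i=c_j$ and $C_i\in Left(T)$, $C_j\in Right(T)$, or $c_i=c_j$, both in $Left(T)$ and $i<j$, or $c_i=c_j$, both in $Right(T)$ and $i>j$. A $01$-filling assigns $0$ or $1$ to each cell; an ascent (resp. descent) of $F$ is a pair of $1$-cells, the second strictly above (resp. strictly below) and strictly to the right of the first, such that the smallest rectangle containing both is contained in $T$; $\mathrm{ne}_2(F)$, $\mathrm{se}_2(F)$ count ascents and descents. A row/column is empty if all its cells are $0$; $\mathrm{ER}(F)$, $\mathrm{EC}(F)$ are the sets of indices of empty rows and empty columns. $\mathcal{N}^c(T,\mathbf{m};A)$ is the set of $01$-fillings with at most one $1$ in each column, exactly $m_i$ ones in row $R_i$ for all $i$, and $\mathrm{EC}(F)=A$. $\mathcal{N}^r(T,\mathbf{n};B)$ is the set of $01$-fillings with at most one $1$ in each row, exactly $n_j$ ones in column $C_j$ for all $j$, and $\mathrm{ER}(F)=B$. If $R_{i_1}\prec\cdots\prec R_{i_s}$ and $C_{j_1}\prec\cdots\prec C_{j_t}$, set $h_{i_u}=r_{i_u}-(m_{i_1}+\cdots+m_{i_{u-1}})-a_{i_u}$, where $a_{i_u}$ is the number of $k\in A$ such that $C_k$ intersects $R_{i_u}$, and $h'_{j_v}=c_{j_v}-(n_{j_1}+\cdots+n_{j_{v-1}})-b_{j_v}$, where $b_{j_v}$ is the number of $k\in B$ such that $R_k$ intersects $C_{j_v}$. $p,q$-notation: $[r]_{p,q}=\frac{p^r-q^r}{p-q}=\sum_{i=0}^{r-1}p^{r-1-i}q^i$,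 $[r]_{p,q}!=\prod_{i=1}^r[i]_{p,q}$, and for integers $n,k$: ${n\brack k}_{p,q}=\frac{[n]_{p,q}!}{[k]_{p,q}![n-k]_{p,q}!}$ if $0\le k\le n$ and $0$ otherwise.
   Formalization: The first identity is proved when m_1+…+m_s+|A| ≥ t and the second when n_1+…+n_t+|B| ≥ s; without this they can fail (one cell, m=(0), A empty: left side 0, right side 1). *)

(* Defs.v *)
From HB Require Import structures.
From mathcomp Require Import all_boot all_order all_algebra fraction.
From mathcomp Require Import mpoly.

Set Implicit Arguments.
Unset Strict Implicit.
Unset Printing Implicit Defensive.

Import GRing.Theory Num.Theory.

Local Open Scope ring_scope.

(* The cell (i, j) lies in row i, counted from the top, and in column j,
   counted from the left; T is a set of cells in its s x t bounding box. *)
Section MoonPolyomino.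

Variables s t : nat.
Implicit Types (T F : {set 'I_s * 'I_t}).

Definition row_cells T (i : 'I_s) : {set 'I_s * 'I_t} := [set x in T | x.1 == i].
Definition col_cells T (j : 'I_t) : {set 'I_s * 'I_t} := [set x in T | x.2 == j].

Definition row_positions T (i : 'I_s) : {set 'I_t} := [set j | (i, j) \in T].
Definition col_positions T (j : 'I_t) : {set 'I_s} := [set i | (i, j) \in T].

(* The bounding box is tight, so that T has exactly s rows and t columns. *)
Definition spans_box T : Prop :=
  (forall i, row_cells T i != set0) /\ (forall j, col_cells T j != set0).

Definition convex_cells T : Prop :=
  (forall (i : 'I_s) (j1 j j2 : 'I_t), (j1 <= j <= j2)%N ->
     (i, j1) \in T -> (i, j2) \in T -> (i, j) \in T) /\
  (forall (j : 'I_t) (i1 i i2 : 'I_s), (i1 <= i <= i2)%N ->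
     (i1, j) \in T -> (i2, j) \in T -> (i, j) \in T).

Definition intersection_free T : Prop :=
  (forall i1 i2, (row_positions T i1 \subset row_positions T i2) ||
                 (row_positions T i2 \subset row_positions T i1)) /\
  (forall j1 j2, (col_positions T j1 \subset col_positions T j2) ||
                 (col_positions T j2 \subset col_positions T j1)).

Definition moon_polyomino T : Prop :=
  [/\ spans_box T, convex_cells T & intersection_free T].

Definition row_len T (i : 'I_s) : nat := #|row_cells T i|.
Definition col_len T (j : 'I_t) : nat := #|col_cells T j|.

Definition row_peak T : nat :=
  \max_(i < s | row_len T i == \max_(k < s) row_len T k) i.
Definition col_peak T : nat :=
  \max_(j < t | col_len T j == \max_(k < t) col_len T k) j.

Definition up_rows T : {set 'I_s} := [set i : 'I_s | (i <= row_peak T)%N].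
Definition low_rows T : {set 'I_s} := [set i : 'I_s | (row_peak T < i)%N].
Definition left_cols T : {set 'I_t} := [set j : 'I_t | (j <= col_peak T)%N].
Definition right_cols T : {set 'I_t} := [set j : 'I_t | (col_peak T < j)%N].

Definition row_prec T (i j : 'I_s) : bool :=
  (row_len T i < row_len T j)%N ||
  (row_len T i == row_len T j) &&
    [|| (i \in up_rows T) && (j \in low_rows T),
        [&& i \in up_rows T, j \in up_rows T & (i < j)%N] |
        [&& i \in low_rows T, j \in low_rows T & (j < i)%N]].

Definition col_prec T (i j : 'I_t) : bool :=
  (col_len T i < col_len T j)%N ||
  (col_len T i == col_len T j) &&
    [|| (i \in left_cols T) && (j \in right_cols T),
        [&& i \in left_cols T, j \in left_cols T & (i < j)%N] |
        [&& i \in right_cols T, j \in right_cols T & (j < i)%N]].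

(* A 01-filling of T is encoded by the set F of its 1-cells. *)
Definition filling T F : bool := F \subset T.

Definition rectangle (x y : 'I_s * 'I_t) : {set 'I_s * 'I_t} :=
  [set z : 'I_s * 'I_t | (minn x.1 y.1 <= z.1 <= maxn x.1 y.1)%N &&
                         (minn x.2 y.2 <= z.2 <= maxn x.2 y.2)%N].

(* Row indices increase downwards: strictly above means a smaller index. *)
Definition ascents T F : {set ('I_s * 'I_t) * ('I_s * 'I_t)} :=
  [set xy | [&& xy.1 \in F, xy.2 \in F, (xy.2.1 < xy.1.1)%N,
                (xy.1.2 < xy.2.2)%N & rectangle xy.1 xy.2 \subset T]].

Definition descents T F : {set ('I_s * 'I_t) * ('I_s * 'I_t)} :=
  [set xy | [&& xy.1 \in F, xy.2 \in F, (xy.1.1 < xy.2.1)%N,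
                (xy.1.2 < xy.2.2)%N & rectangle xy.1 xy.2 \subset T]].

Definition ne2 T F : nat := #|ascents T F|.
Definition se2 T F : nat := #|descents T F|.

Definition empty_rows F : {set 'I_s} := [set i | row_cells F i == set0].
Definition empty_cols F : {set 'I_t} := [set j | col_cells F j == set0].

Definition Nc T (m : 'I_s -> nat) (A : {set 'I_t}) : {set {set 'I_s * 'I_t}} :=
  [set F | [&& filling T F, [forall j, #|col_cells F j| <= 1],
               [forall i, #|row_cells F i| == m i] & empty_cols F == A]]%N.

Definition Nr T (n : 'I_t -> nat) (B : {set 'I_s}) : {set {set 'I_s * 'I_t}} :=
  [set F | [&& filling T F, [forall i, #|row_cells F i| <= 1],
               [forall j, #|col_cells F j| == n j] & empty_rows F == B]]%N.

(* The sums range over the predecessors of d in the total order; the values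
   may be negative. *)
Definition h T (m : 'I_s -> nat) (A : {set 'I_t}) (d : 'I_s) : int :=
  (row_len T d)%:Z - (\sum_(k | row_prec T k d) m k)%N%:Z
  - #|[set k in A | col_cells T k :&: row_cells T d != set0]|%:Z.

Definition h' T (n : 'I_t -> nat) (B : {set 'I_s}) (d : 'I_t) : int :=
  (col_len T d)%:Z - (\sum_(k | col_prec T k d) n k)%N%:Z
  - #|[set k in B | row_cells T k :&: col_cells T d != set0]|%:Z.

End MoonPolyomino.

Section PQBinomial.

Variables (K : fieldType) (p q : K).

Definition pq_int (r : nat) : K := \sum_(i < r) p ^+ (r - 1 - i) * q ^+ i.

Definition pq_fact (r : nat) : K := \prod_(1 <= i < r.+1) pq_int i.

Definition pq_binom (n k : int) : K :=
  if (0 <= k <= n)%R then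
    pq_fact `|n|%N / (pq_fact `|k|%N * pq_fact `|n - k|%N)
  else 0.

Lemma pq_intE r : p != q -> pq_int r = (p ^+ r - q ^+ r) / (p - q).
Proof.
rewrite -subr_eq0 => pq_neq0; rewrite subrXX mulrAC divff // mul1r.
by apply: eq_bigr => i _; rewrite subn1.
Qed.

End PQBinomial.

(* p and q are indeterminates: the two generators of the field of fractions of
   Z[p, q], where the quotients defining the binomial coefficients make sense. *)
Definition pq_field : fieldType := {fraction {mpoly int[2]}}.
Definition p : pq_field := tofrac ('X_(0 : 'I_2) : {mpoly int[2]}).
Definition q : pq_field := tofrac ('X_(1 : 'I_2) : {mpoly int[2]}).

(* Main.v *)
Require Import Defs.
From mathcomp Require Import all_boot all_order all_algebra fraction.
From mathcomp Require Import mpoly.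
From mathcomp Require Import zify ring.

Set Implicit Arguments.
Unset Strict Implicit.
Unset Printing Implicit Defensive.

Import GRing.Theory Num.Theory.

Local Open Scope ring_scope.

(* Process the rows of T in the order of row_prec.  Rows are nested along this
   order, so a pair of 1-cells lies in a rectangle of T exactly when the column
   of the later cell meets the earlier row.  If t = sum m + |A|, every column
   outside A carries exactly one 1, so an open column left unused by row d is
   filled later, strictly below d when d is in the upper half and strictly above
   d otherwise.  Hence the ascents and descents whose earlier row is d are
   governed by the set S of columns chosen in row d among the h_d open ones:
   they are the pairs (chosen, not chosen), sorted by which comes first, and
   summing over S gives a p,q-binomial coefficient, depending on the earlier
   choices only through their cardinals.  The second identity is the first one
   for the transposed polyomino. *)

(** * Symmetry and Pascal recurrence of the p,q-binomial coefficients *)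

Section PQBinomialTheory.

Variables (K : fieldType) (x y : K).

(** Cut the sum at index [a]: the first [a] terms share the factor [x ^+ b], the last [b] terms the
    factor [y ^+ a]. *)
Lemma pq_intD a b :
  pq_int x y (a + b) = x ^+ b * pq_int x y a + y ^+ a * pq_int x y b.
Proof.
rewrite /pq_int big_split_ord /= !mulr_sumr; congr (_ + _).
  apply: eq_bigr => i _; rewrite mulrA -exprD; congr (_ ^+ _ * _).
  by have := ltn_ord i; lia.
apply: eq_bigr => i _; rewrite exprD mulrCA; congr (_ * (_ ^+ _ * _)).
by have := ltn_ord i; lia.
Qed.

Lemma pq_intC r : pq_int x y r = pq_int y x r.
Proof.
rewrite /pq_int (reindex_inj rev_ord_inj) /=; apply: eq_bigr => i _.
by rewrite mulrC; congr (_ ^+ _ * _ ^+ _); have := ltn_ord i; lia.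
Qed.

Lemma pq_binomC a b : pq_binom x y a b = pq_binom y x a b.
Proof.
have factC r : pq_fact x y r = pq_fact y x r.
  by apply: eq_bigr => i _; exact: pq_intC.
by rewrite /pq_binom !factC.
Qed.

Lemma pq_factS r : pq_fact x y r.+1 = pq_fact x y r * pq_int x y r.+1.
Proof. by rewrite /pq_fact big_nat_recr. Qed.

Lemma pq_fact0 : pq_fact x y 0 = 1.
Proof. by rewrite /pq_fact big_geq. Qed.

Lemma pq_binom_nat a b :
  pq_binom x y (a + b)%N%:Z a%:Z =
  pq_fact x y (a + b) / (pq_fact x y a * pq_fact x y b).
Proof.
rewrite /pq_binom ifT; last by lia.
by congr (pq_fact _ _ _ / (pq_fact _ _ _ * pq_fact _ _ _)); lia.
Qed.

Lemma pq_binom_small (n k : nat) : (n < k)%N -> pq_binom x y n%:Z k%:Z = 0.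
Proof. by move=> ltnk; rewrite /pq_binom ifF //; lia. Qed.

(** Keeps the factorials in the denominators invertible; it is proved below for the two
    indeterminates. *)
Hypothesis pq_int_neq0 : forall r, pq_int x y r.+1 != 0.

Lemma pq_fact_neq0 r : pq_fact x y r != 0.
Proof.
elim: r => [|r IHr]; first by rewrite pq_fact0 oner_eq0.
by rewrite pq_factS mulf_neq0.
Qed.

Lemma pq_binom0 (n : nat) : pq_binom x y n%:Z 0%:Z = 1.
Proof.
by rewrite (pq_binom_nat 0 n) pq_fact0 mul1r divff // pq_fact_neq0.
Qed.

(** Over a common denominator this is [pq_intD] for [n + 1 = (k + 1) + (n - k)]. When [n < k] all
    three coefficients vanish, so the truncated subtraction is harmless. *)
Lemma pq_binomS (n k : nat) :
  pq_binom x y n.+1%:Z k.+1%:Z =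
  x ^+ (n - k) * pq_binom x y n%:Z k%:Z
  + y ^+ k.+1 * pq_binom x y n%:Z k.+1%:Z.
Proof.
have [ltnk|lekn] := ltnP n k.
  by rewrite !pq_binom_small ?mulr0 ?addr0 //; lia.
have [j ->] : exists j, n = (k + j)%N by exists (n - k)%N; lia.
have nz := pq_fact_neq0.
have binE a : pq_binom x y a%:Z a%:Z = 1.
  by have := pq_binom_nat a 0; rewrite addn0 pq_fact0 mulr1 divff.
rewrite addKn; case: j => [|j].
  by rewrite addn0 (pq_binom_small (ltnSn k)) !binE expr0 mul1r mulr0 addr0.
have binD1 := pq_binom_nat k.+1 j.+1; have binD2 := pq_binom_nat k.+1 j.
rewrite addSn in binD1; rewrite addSnnS in binD2.
rewrite binD1 binD2 pq_binom_nat (pq_factS (k + j.+1)) (pq_factS k) (pq_factS j).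
rewrite -addSn pq_intD.
have := nz k; have := nz j; have := pq_int_neq0 k; have := pq_int_neq0 j.
move: (pq_fact x y (k + j.+1)) (pq_fact x y k) (pq_fact x y j) => f1 f2 f3.
move: (pq_int x y k.+1) (pq_int x y j.+1) => g1 g2.
by move=> *; field; repeat (apply/andP; split).
Qed.

End PQBinomialTheory.

(** * Inversion statistic on the subsets of a set of columns *)

Section Crossings.

Variable t : nat.
Implicit Types X Y Q S : {set 'I_t}.

(** A double sum of 0/1 values rather than a cardinal, so that adjoining one element on either side
    is additive. *)
Definition crossings X Y : nat := (\sum_(u in X) \sum_(v in Y) (u < v))%N.

Lemma card_crossings X Y :
  #|[set uv : 'I_t * 'I_t | [&& uv.1 \in X, uv.2 \in Y & (uv.1 < uv.2)%N]]|
  = crossings X Y.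
Proof.
rewrite /crossings pair_big_dep -sum1_card /=.
rewrite [RHS]big_mkcond [LHS]big_mkcond.
apply: eq_bigr => -[u v] _; rewrite inE /=.
by case: (u \in X); case: (v \in Y) => //=; case: ltnP.
Qed.

Lemma crossings_setU1l X Y v : v \notin X ->
  crossings (v |: X) Y = ((\sum_(w in Y) (v < w)) + crossings X Y)%N.
Proof. by move=> vX; rewrite /crossings big_setU1. Qed.

Lemma crossings_setU1r X Y v : v \notin Y ->
  crossings X (v |: Y) = ((\sum_(u in X) (u < v)) + crossings X Y)%N.
Proof.
move=> vY; rewrite /crossings -big_split /=.
by apply: eq_bigr => u _; rewrite big_setU1.
Qed.

Variables (K : fieldType) (x y : K).
Hypothesis pq_int_neq0 : forall r, pq_int x y r.+1 != 0.

(** Induction on [#|Q|], removing the greatest column [v]. If [v] is not in [S], the [k] elements of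
    [S] all precede it and give [y ^+ k]; if it is, the unchosen columns all precede it and give a
    power of [x]. These are the two terms of [pq_binomS]. *)
Lemma sum_crossings Q (k : nat) :
  \sum_(S : {set 'I_t} | (S \subset Q) && (#|S| == k))
     x ^+ crossings (Q :\: S) S * y ^+ crossings S (Q :\: S)
  = pq_binom x y #|Q|%:Z k%:Z.
Proof.
elim: {Q}#|Q| {-2}Q (erefl #|Q|) k => [|n IHn] Q cardQ k.
  have -> : Q = set0 by apply/eqP; rewrite -cards_eq0 cardQ.
  case: k => [|k].
    rewrite (big_pred1 set0) => [|S]; last by rewrite subset0 cards_eq0 andbb.
    by rewrite set0D /crossings !big_set0 mulr1 cards0 pq_binom0.
  rewrite cards0 pq_binom_small // big_pred0 // => S.
  by rewrite subset0; apply/andP => -[/eqP-> ]; rewrite cards0.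
have [v0 v0Q] : exists v, v \in Q by apply/set0Pn; rewrite -card_gt0 cardQ.
pose v := [arg max_(v > v0 in Q) (v : nat)].
have [vQ vmax] : v \in Q /\ forall u, u \in Q -> (u <= v)%N.
  by rewrite /v; case: arg_maxnP => // i iQ im; split.
have cardQ' : #|Q :\ v| = n by have := cardsD1 v Q; rewrite vQ; lia.
have ltv u : u \in Q :\ v -> (u < v)%N.
  rewrite !inE => /andP[uv uQ]; rewrite ltn_neqAle vmax // andbT.
  by apply: contra uv => /eqP/val_inj->.
have ltvS S : S \subset Q :\ v -> (\sum_(u in S) (u < v) = #|S|)%N.
  move=> /subsetP SQ; rewrite -sum1_card; apply: eq_bigr => u /SQ/ltv.
  by move=> ->.
have gtvS S : S \subset Q :\ v -> (\sum_(u in S) (v < u) = 0)%N.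
  move=> /subsetP SQ; rewrite big1 // => u /SQ/ltv.
  by case: ltngtP.
have vNS S : S \subset Q :\ v -> v \notin S.
  by move=> /subsetP SQ; apply/negP => /SQ; rewrite !inE eqxx.
pose without := \sum_(S : {set 'I_t} | (S \subset Q :\ v) && (#|S| == k))
     x ^+ crossings ((Q :\ v) :\: S) S * y ^+ (k + crossings S ((Q :\ v) :\: S)).
have withoutE : without = y ^+ k * pq_binom x y n%:Z k%:Z.
  rewrite -cardQ' -IHn // mulr_sumr; apply: eq_bigr => S _.
  by rewrite exprD mulrCA.
have sumwo : \sum_(S : {set 'I_t} | (S \subset Q) && (#|S| == k) && (v \notin S))
     x ^+ crossings (Q :\: S) S * y ^+ crossings S (Q :\: S) = without.
  apply: eq_big => [S|S /andP[/andP[SQ /eqP Sk] vS]].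
    by rewrite subsetD1 andbAC.
  have SQ' : S \subset Q :\ v by rewrite subsetD1 SQ.
  have -> : Q :\: S = v |: ((Q :\ v) :\: S).
    apply/setP => u; rewrite !inE; case: (eqVneq u v) => [->|] //=.
    by rewrite vQ vS.
  have vN : v \notin (Q :\ v) :\: S by rewrite !inE eqxx andbF.
  by rewrite crossings_setU1l // crossings_setU1r // gtvS // ltvS // Sk.
rewrite (bigID (fun S : {set 'I_t} => v \in S)) /= sumwo withoutE.
rewrite cardQ; case: k {sumwo} @without {withoutE} => [|k] without.
  rewrite big_pred0 ?add0r ?mul1r ?pq_binom0 // => S.
  by rewrite cards_eq0; apply/andP => -[/andP[_ /eqP->]]; rewrite inE.
rewrite pq_binomS //; congr (_ + _).
rewrite -cardQ' -IHn // mulr_sumr.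
(* The side condition [(v |: S) :\ v = S] of this reindexing says that [v] is not in the new [S]. *)
rewrite (reindex_onto (fun S : {set 'I_t} => v |: S) (fun S => S :\ v)) /=; last first.
  by move=> S /andP[_ vS]; rewrite setD1K.
apply: eq_big => [S|S].
  rewrite subUset sub1set vQ setU11 andbT /= subsetD1 cardsU1.
  have [vS|vS] := boolP (v \in S).
    rewrite !andbF /=; apply/negP => /andP[_ /eqP/setP/(_ v)].
    by rewrite vS !inE eqxx.
  by rewrite setU1K // eqxx !andbT eqSS.
rewrite subUset sub1set vQ cardsU1 => /andP[/andP[/andP[SQ Sk] _] /eqP SvS].
have vS : v \notin S by rewrite -SvS !inE eqxx.
rewrite vS /= in SQ Sk; have {Sk} Sk : #|S| = k by apply/eqP; rewrite -eqSS.
have SQ' : S \subset Q :\ v by rewrite subsetD1 SQ.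
have DQ : (Q :\ v) :\: S \subset Q :\ v by apply: subsetDl.
have -> : Q :\: (v |: S) = (Q :\ v) :\: S by rewrite setDDl.
rewrite crossings_setU1l // crossings_setU1r // gtvS // ltvS //.
rewrite cardsD (setIidPr SQ') Sk exprD -mulrA; congr (_ ^+ _ * _).
Qed.

End Crossings.

(** * Factorization of a sum over fillings, one row at a time *)

Section SumByRows.

Variables (s t : nat) (K : fieldType) (lt : rel 'I_s).
Hypothesis lt_irr : irreflexive lt.
Hypothesis lt_trans : transitive lt.
Hypothesis lt_total : forall i k, i != k -> lt i k || lt k i.
Implicit Types (F : {set 'I_s * 'I_t}) (S : {set 'I_t}) (D : {set 'I_s}).

Definition add_row (d : 'I_s) S F : {set 'I_s * 'I_t} :=
  F :|: [set x | (x.1 == d) && (x.2 \in S)].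

(** Take an element of [D] with the most predecessors: an element of [D] above it would have
    strictly more. *)
Lemma exists_greatest D : D != set0 ->
  exists2 d, d \in D & forall k, k \in D -> k != d -> lt k d.
Proof.
case/set0Pn => d0 d0D; pose rank d := #|[set k | lt k d]|.
case: (arg_maxnP (P := fun k => k \in D) rank d0D) => d dD dmax;
exists d => // k kD kd.
have /orP[//|ltdk] := lt_total kd; have := dmax k kD; rewrite /= leqNgt.
case/negP; apply: proper_card; apply/properP; split.
  by apply/subsetP => i; rewrite !inE => /lt_trans; apply.
by exists d; rewrite !inE ?ltdk ?lt_irr.
Qed.

(* Summing over the greatest row first makes each inner sum a constant. *)
Lemma sum_by_rows (w : 'I_s -> {set 'I_s * 'I_t} -> K) (c : 'I_s -> K) :
  (forall d F F', (forall x : 'I_s * 'I_t,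
       (x.1 == d) || lt x.1 d -> (x \in F) = (x \in F')) ->
     w d F = w d F') ->
  (forall d F, (forall x, x \in F -> lt x.1 d) ->
     (forall k, lt k d -> w k F != 0) -> \sum_S w d (add_row d S F) = c d) ->
  \sum_F \prod_d w d F = \prod_d c d.
Proof.
move=> w_local w_sum.
(* Generalized to down-closed sets of rows, a property that survives the removal of the greatest
   row. *)
have claim n D : #|D| = n -> (forall d k, d \in D -> lt k d -> k \in D) ->
    \sum_(F : {set 'I_s * 'I_t} | [forall x in F, x.1 \in D]) \prod_(d in D) w d F
    = \prod_(d in D) c d.
  elim: n D => [|n IHn] D cardD downD.
    have D0 : D = set0 by apply/eqP; rewrite -cards_eq0 cardD.
    rewrite D0 big_set0 (big_pred1 set0) ?big_set0 // => F.
    apply/forall_inP/eqP => [noF|-> x]; last by rewrite inE.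
    by apply/setP => x; rewrite inE; apply/negP => /noF; rewrite inE.
  have Dn0 : D != set0 by rewrite -cards_eq0 cardD.
  have [d dD dmax] := exists_greatest Dn0.
  have cardD' : #|D :\ d| = n by have := cardsD1 d D; rewrite dD; lia.
  (* As [D] is down-closed with greatest element [d], the remaining rows are exactly the
     predecessors of [d]. *)
  have ltd k : (k \in D :\ d) = lt k d.
    apply/idP/idP => [|ltkd]; first by rewrite !inE => /andP[/dmax H /H].
    rewrite !inE (downD _ _ dD ltkd) andbT.
    by apply: contraTneq ltkd => ->; rewrite lt_irr.
  have downD' e k : e \in D :\ d -> lt k e -> k \in D :\ d.
    by rewrite !ltd => lted ltke; apply: lt_trans lted.
  rewrite (big_setD1 d) //= -(IHn _ cardD' downD') mulr_sumr.
  (* A filling amounts to its part outside row [d] together with the set of columns it uses in row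
     [d]. *)
  pose split F := ([set x in F | x.1 != d], row_positions F d).
  rewrite (reindex_onto (fun FS => add_row d FS.2 FS.1) split) /=; last first.
    move=> F _; apply/setP => -[i j]; rewrite !inE /=.
    by case: eqVneq => [->|]; rewrite ?andbF ?orbF ?andbT.
  rewrite (eq_bigl (fun FS : {set 'I_s * 'I_t} * {set 'I_t} =>
    [forall x in FS.1, x.1 \in D :\ d] && true)); last first.
    move=> [F S] /=; rewrite andbT; apply/andP/forall_inP.
      move=> [/forall_inP FD /eqP[Fd _]] x xF; rewrite !inE.
      have := xF; rewrite -{1}Fd inE => /andP[xFS ->] /=.
      exact: FD.
    move=> FD; have Fd i j : (i, j) \in F -> i != d.
      by move=> /FD; rewrite !inE => /andP[].
    split.
      apply/forall_inP => x; rewrite !inE => /orP[/FD|/andP[/eqP->] //].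
      by rewrite !inE => /andP[].
    apply/eqP; congr (_, _).
      apply/setP => -[i j]; rewrite !inE /=.
      have := Fd i j; case: (_ \in F) => [-> //|_].
      by case: eqVneq => //=; rewrite andbF.
    apply/setP => j; rewrite !inE eqxx /=; have := Fd d j.
    by case: (_ \in F) => [/(_ isT)|_]; rewrite ?eqxx.
  rewrite -(pair_big_dep (fun F : {set 'I_s * 'I_t} => [forall x in F, x.1 \in D :\ d])
    (fun _ _ => true)
    (fun F S => \prod_(k in D) w k (add_row d S F))) /=.
  apply: eq_bigr => F /forall_inP FD.
  transitivity (\sum_S w d (add_row d S F) * \prod_(k in D :\ d) w k F).
    apply: eq_bigr => S _; rewrite (big_setD1 d) //=; congr (_ * _).
    apply: eq_bigr => k; rewrite ltd => ltkd; apply: w_local => x xk.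
    rewrite inE orbC inE; case: eqVneq => [xd|] //=.
    move: xk; rewrite xd => /orP[/eqP dk|ltdk].
      by move: ltkd; rewrite dk lt_irr.
    by have := lt_trans ltkd ltdk; rewrite lt_irr.
  (* If the earlier product is 0, so are both sides; otherwise every earlier weight is nonzero, as
     [w_sum] requires. *)
  rewrite -mulr_suml; have [->|w_neq0] := eqVneq (\prod_(k in D :\ d) w k F) 0.
    by rewrite !mulr0.
  rewrite w_sum // => [x /FD|k]; rewrite -?ltd //.
  by move=> kD; move/prodf_neq0: w_neq0; apply.
transitivity (\sum_(F : {set 'I_s * 'I_t} | [forall x in F, x.1 \in [set: 'I_s]])
                \prod_(d in [set: 'I_s]) w d F).
  apply: eq_big => [F|F _]; last by apply: eq_bigl => d; rewrite inE.
  by apply/esym/forall_inP => x _; rewrite inE.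
rewrite (claim #|[set: 'I_s]|) //; last by move=> *; rewrite inE.
by apply: eq_bigl => d; rewrite inE.
Qed.

End SumByRows.

(** * Counting cells by rows and pairs of cells by columns *)

Section Cells.

Variables s t : nat.
Implicit Types F T : {set 'I_s * 'I_t}.

Lemma mem_row_positions F i j : (j \in row_positions F i) = ((i, j) \in F).
Proof. by rewrite inE. Qed.

Lemma card_row_positions F i : #|row_positions F i| = #|row_cells F i|.
Proof.
rewrite -(card_imset (row_positions F i) (f := pair i)) => [|j k []] //.
apply: eq_card => -[k j]; rewrite !inE /=; apply/imsetP/andP => [[j']|].
  by rewrite inE => jF [-> ->].
by move=> [kF /eqP ik]; exists j; rewrite -ik // inE.
Qed.

Lemma card_by_rows F : #|F| = (\sum_i #|row_positions F i|)%N.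
Proof.
rewrite -sum1_card (partition_big (fun x => x.1) xpredT) //=.
apply: eq_bigr => i _; rewrite card_row_positions -sum1_card.
by apply: eq_bigl => x; rewrite inE.
Qed.

Lemma col_cells_neq0 F j : (col_cells F j != set0) = (j \in snd @: F).
Proof.
apply/set0Pn/imsetP => [[[i k]]|[[i k] ikF ->]]; last by exists (i, k); rewrite inE ikF /=.
by rewrite inE => /andP[ikF /eqP <-]; exists (i, k).
Qed.

Lemma rectangleC (x y : 'I_s * 'I_t) : rectangle x y = rectangle y x.
Proof.
by apply/setP => z; rewrite !inE (minnC x.1) (minnC x.2) (maxnC x.1) (maxnC x.2).
Qed.

(** A cell of [F] is determined by its column, hence a pair in [Z] by its two columns. *)
Lemma card_pairs_crossings F (Z : {set ('I_s * 'I_t) * ('I_s * 'I_t)})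
    (X Y : {set 'I_t}) :
  {in F &, injective snd} ->
  (forall x y, (x, y) \in Z -> [/\ x \in F, y \in F & (x.2 < y.2)%N] /\
     (x.2 \in X /\ y.2 \in Y)) ->
  (forall u v, u \in X -> v \in Y -> (u < v)%N ->
     exists x y, [/\ (x, y) \in Z, x.2 = u & y.2 = v]) ->
  #|Z| = crossings X Y.
Proof.
move=> injF Zsub Zsur; rewrite -card_crossings.
pose f (xy : ('I_s * 'I_t) * ('I_s * 'I_t)) := (xy.1.2, xy.2.2).
have injf : {in Z &, injective f}.
  move=> [x y] [x' y'] /Zsub[[xF yF _] _] /Zsub[[xF' yF' _] _] [].
  by move=> /(injF _ _ xF xF')-> /(injF _ _ yF yF')->.
rewrite -(card_in_imset injf); apply: eq_card => -[u v]; rewrite inE /=.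
apply/imsetP/and3P => [[[x y] xyZ [-> ->]]|[uX vY ltuv]].
  by have [[_ _ ?] [? ?]] := Zsub _ _ xyZ.
by have [x [y [xyZ <- <-]]] := Zsur _ _ uX vY ltuv; exists (x, y).
Qed.

End Cells.

(** * The order on rows and the geometry of a moon polyomino *)

Section RowOrder.

Variables s t : nat.
Variable T : {set 'I_s * 'I_t}.
Local Notation lt := (row_prec T).
Local Notation pk := (row_peak T).

Lemma row_precE (i k : 'I_s) : lt i k =
  (row_len T i < row_len T k)%N || (row_len T i == row_len T k) &&
  [|| (i <= pk)%N && (pk < k)%N, [&& (i <= pk)%N, (k <= pk)%N & (i < k)%N] |
      [&& (pk < i)%N, (pk < k)%N & (k < i)%N]].
Proof. by rewrite /row_prec !inE. Qed.

Lemma row_prec_irr : irreflexive lt.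
Proof. by move=> i; rewrite row_precE; lia. Qed.

Lemma row_prec_trans : transitive lt.
Proof. by move=> j i k; rewrite !row_precE; lia. Qed.

Lemma row_prec_total i k : i != k -> lt i k || lt k i.
Proof.
move=> ik; have {ik} ik : (i : nat) <> k by move/val_inj/eqP; rewrite (negPf ik).
by rewrite !row_precE; lia.
Qed.

Hypothesis moonT : moon_polyomino T.

Lemma row_positions_subset i k :
  (row_len T i <= row_len T k)%N -> row_positions T i \subset row_positions T k.
Proof.
case: moonT => _ _ [chain _]; rewrite /row_len -!card_row_positions => leik.
have /orP[//|ki] := chain i k.
by have /eqP-> : row_positions T k == row_positions T i by rewrite eqEcard ki.
Qed.

Lemma row_prec_subset i k : lt i k -> row_positions T i \subset row_positions T k.
Proof. by move=> ltik; apply: row_positions_subset; move: ltik; rewrite row_precE; lia. Qed.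

(** A longest row at the peak contains all positions of row [i]; by convexity of columns every row
    in between contains them too. *)
Lemma row_len_unimodal (i k : 'I_s) :
  (i <= k <= pk)%N || (pk <= k <= i)%N -> (row_len T i <= row_len T k)%N.
Proof.
move=> iku; case: moonT => _ [_ convex_col] _.
pose M := (\max_(l < s) row_len T l)%N.
have [l0 ml0] := bigop.eq_bigmax (row_len T) (introT card_gt0P (ex_intro _ i isT)).
have Ml0 : row_len T l0 == M by rewrite /M ml0.
pose i0 : 'I_s := [arg max_(l > l0 | row_len T l == M) l].
have pkE : pk = i0 by exact: (bigop.bigmax_eq_arg _ Ml0).
have lenM : row_len T i0 = M by rewrite /i0; case: arg_maxnP => // l /eqP.
have sub_i0 : row_positions T i \subset row_positions T i0.
  by apply: row_positions_subset; rewrite lenM; exact: bigop.leq_bigmax.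
rewrite /row_len -!card_row_positions; apply/subset_leq_card/subsetP => j ji.
have := subsetP sub_i0 j ji; move: ji; rewrite !inE => ji ji0.
case/orP: iku; rewrite pkE => iku; first exact: convex_col ji ji0.
exact: convex_col ji0 ji.
Qed.

(** A later row always lies on the side of the peak: a row farther from the peak on the side of [i]
    is at most as long by unimodality, and the tie-breaking rule puts it first. *)
Lemma row_prec_position (i k : 'I_s) : lt i k -> (i < k)%N = (i <= pk)%N.
Proof.
move=> ltik; have neik : (i : nat) <> k.
  by move=> /val_inj ik; move: ltik; rewrite ik row_prec_irr.
have := @row_len_unimodal k i; move: ltik; rewrite row_precE; lia.
Qed.

(** Convexity fills the side in the earlier row, nesting copies it to the later row, and convexity
    of columns fills the rest. *)
Lemma rectangle_subset (x y : 'I_s * 'I_t) : x \in T -> y \in T -> lt x.1 y.1 ->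
  (rectangle x y \subset T) = (y.2 \in row_positions T x.1).
Proof.
case: x y => [i u] [k v] /= xT yT ltik; case: moonT => _ [convex_row convex_col] _.
rewrite inE; apply/subsetP/idP => [|ivT].
  by apply; rewrite inE /=; lia.
move=> [a b]; rewrite inE /= => /andP[ha hb].
have ibT : (i, b) \in T.
  case: (leqP u v) hb => uv hb; last exact: convex_row ivT xT.
  exact: convex_row xT ivT.
have kbT : (k, b) \in T.
  by have := subsetP (row_prec_subset ltik) b; rewrite !inE; apply.
case: (leqP i k) ha => ik ha; first exact: convex_col ibT kbT.
exact: convex_col kbT ibT.
Qed.

End RowOrder.

(** * Fillings with at most one 1 in each column, described row by row *)

Section ColumnFillings.

Variables (s t : nat) (T : {set 'I_s * 'I_t}) (m : 'I_s -> nat) (A : {set 'I_t}).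
Hypothesis moonT : moon_polyomino T.
Local Notation lt := (row_prec T).
Local Notation up d := (nat_of_ord d <= row_peak T)%N.
Implicit Types F : {set 'I_s * 'I_t}.

(** Reads only the rows of [F] before [d], so it is unaffected by the choice made in row [d]. *)
Definition available F (d : 'I_s) : {set 'I_t} :=
  [set j in row_positions T d |
    (j \notin A) && ~~ [exists k, lt k d && ((k, j) \in F)]].

Definition valid_row F d : bool :=
  (row_positions F d \subset available F d) && (#|row_positions F d| == m d).

Lemma valid_rowP F d j : valid_row F d -> (d, j) \in F ->
  [/\ (d, j) \in T, j \notin A & forall k, lt k d -> (k, j) \notin F].
Proof.
move=> /andP[/subsetP/(_ j) + _]; rewrite !inE => /[apply].
case/and3P => -> -> /existsPn noF; split => // k ltkd.
by have := noF k; rewrite ltkd.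
Qed.

(** Of two cells in one column but in different rows, the one in the later row would use a column
    already taken. *)
Lemma valid_rows_inj F : (forall x, x \in F -> valid_row F x.1) ->
  {in F &, injective snd}.
Proof.
move=> validF [i j] [k j'] ijF kjF /= jj'; rewrite {}jj' in ijF *.
congr (_, _); apply/eqP; apply: contraT => /(row_prec_total T) /orP[] ltik.
  by have [_ _ /(_ _ ltik)] := valid_rowP (validF _ kjF) kjF; rewrite ijF.
by have [_ _ /(_ _ ltik)] := valid_rowP (validF _ ijF) ijF; rewrite kjF.
Qed.

Lemma card_available F d :
  (forall x, x \in F -> lt x.1 d) -> (forall k, lt k d -> valid_row F k) ->
  (#|available F d|)%:Z = h T m A d.
Proof.
move=> Flt validF; have validF' x : x \in F -> valid_row F x.1.
  by move=> /Flt/validF.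
have Pd : row_len T d = #|row_positions T d| by rewrite card_row_positions.
have Ad : #|[set k in A | col_cells T k :&: row_cells T d != set0]|
          = #|row_positions T d :&: A|.
  apply: eq_card => j; rewrite !inE andbC; congr (_ && _).
  apply/set0Pn/idP => [[[k l]]|djT]; last by exists (d, j); rewrite !inE djT /= !eqxx.
  by rewrite !inE /= => /andP[/andP[klT /eqP <-] /andP[_ /eqP <-]].
have Fd : (\sum_(k | lt k d) m k = #|snd @: F|)%N.
  rewrite (card_in_imset (valid_rows_inj validF')) card_by_rows big_mkcond.
  apply: eq_bigr => k _; case: ifP => [/validF/andP[_ /eqP->//]|nltk].
  apply/esym/eqP; rewrite cards_eq0 -subset0; apply/subsetP => j.
  by rewrite inE => /Flt /=; rewrite nltk.
have -> : available F d = (row_positions T d :\: A) :\: snd @: F.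
  apply/setP => j; rewrite !inE.
  have -> : [exists k, lt k d && ((k, j) \in F)] = (j \in snd @: F).
    apply/existsP/imsetP => [[k /andP[_ kjF]]|[[k l] klF ->]].
      by exists (k, j).
    by exists k; rewrite klF (Flt _ klF).
  by rewrite andbA andbC [(_ \in T) && _]andbC.
(* Nesting of rows: a column used by an earlier row also meets row [d], so each used column removes
   exactly one choice. *)
have sub : snd @: F \subset row_positions T d :\: A.
  apply/subsetP => j /imsetP[[k l] klF ->] /=.
  have [klT lA _] := valid_rowP (validF' _ klF) klF.
  rewrite inE lA (subsetP (row_prec_subset moonT (Flt _ klF))) //.
  by rewrite inE.
have := subset_leq_card sub; have := cardsID A (row_positions T d).
rewrite /h Pd Ad Fd (cardsDS sub) => cardP ltcard.
by move: #|_| #|_| #|_| #|_| cardP ltcard => *; lia.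
Qed.

Lemma mem_Nc F : (t <= (\sum_d m d) + #|A|)%N ->
  (F \in Nc T m A) = [forall d, valid_row F d].
Proof.
move=> tmA; apply/idP/forallP.
  rewrite inE => /and4P[/subsetP FT /forallP col1 /forallP rowm /eqP FA] d.
  rewrite /valid_row card_row_positions rowm andbT; apply/subsetP => j.
  rewrite !inE => djF; rewrite FT //=; apply/andP; split.
    rewrite -FA inE col_cells_neq0; apply/imsetP; by exists (d, j).
  apply/existsPn => k; apply/negP => /andP[ltkd kjF].
  have /card_le1_eqP/(_ (k, j) (d, j)) := col1 j.
  by rewrite !inE kjF djF /= eqxx => /(_ isT isT)[kd]; rewrite kd row_prec_irr in ltkd.
move=> validF; have injF : {in F &, injective snd} by apply: valid_rows_inj.
have rowm d : #|row_positions F d| = m d by have /andP[_ /eqP] := validF d.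
have Fm : (\sum_d m d = #|snd @: F|)%N.
  by rewrite (card_in_imset injF) card_by_rows; apply: eq_bigr => d _; rewrite rowm.
have emptyE : empty_cols F = ~: (snd @: F).
  by apply/setP => j; rewrite !inE -col_cells_neq0 negbK.
rewrite inE; apply/and4P; split.
- apply/subsetP => -[i j] ijF.
  by have [] := valid_rowP (validF i) ijF.
- apply/forallP => j; apply/card_le1_eqP => x y; rewrite !inE.
  by move=> /andP[xF /eqP xj] /andP[yF /eqP yj]; apply: injF; rewrite ?xj.
- by apply/forallP => i; rewrite -card_row_positions rowm.
(* The bound on [t] enters here: [A] is contained in the set of empty columns, which has
   [t - sum m <= #|A|] elements, so the two are equal. *)
rewrite eq_sym eqEcard emptyE cardsCs setCK card_ord -Fm leq_subLR tmA andbT.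
apply/subsetP => j jA; rewrite inE; apply/imsetP => -[[k l] klF /= jl].
by have [_] := valid_rowP (validF k) klF; rewrite -jl jA.
Qed.

(** For [d] in the upper half, unchosen columns are filled below [d], so an ascent has its unchosen
    column on the left; in the lower half they are filled above and the sides are exchanged. *)
Definition row_ascents F (d : 'I_s) : nat :=
  if up d then crossings (available F d :\: row_positions F d) (row_positions F d)
  else crossings (row_positions F d) (available F d :\: row_positions F d).

Definition row_descents F (d : 'I_s) : nat :=
  if up d then crossings (row_positions F d) (available F d :\: row_positions F d)
  else crossings (available F d :\: row_positions F d) (row_positions F d).

(* [b = true] gives the ascents and [b = false] the descents. *)
Definition pairs_of (b : bool) F : {set ('I_s * 'I_t) * ('I_s * 'I_t)} :=
  [set xy | [&& xy.1 \in F, xy.2 \in F, (xy.1.2 < xy.2.2)%N,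
     (xy.1.1 != xy.2.1) && ((xy.2.1 < xy.1.1)%N == b) & rectangle xy.1 xy.2 \subset T]].

(** Each pair is charged to the row that is processed first. *)
Definition least_row (xy : ('I_s * 'I_t) * ('I_s * 'I_t)) : 'I_s :=
  if lt xy.1.1 xy.2.1 then xy.1.1 else xy.2.1.

Lemma card_pairs_of b F d : F \in Nc T m A -> (t <= (\sum_d m d) + #|A|)%N ->
  #|[set xy in pairs_of b F | least_row xy == d]| =
  if b then row_ascents F d else row_descents F d.
Proof.
move=> FN tmA; have validF : forall d, valid_row F d by apply/forallP; rewrite -mem_Nc.
have injF : {in F &, injective snd} by apply: valid_rows_inj.
have FT : {subset F <= T}.
  by move=> -[i j] ijF; have [] := valid_rowP (validF i) ijF.
pose R := available F d :\: row_positions F d.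
have in_R x y : x \in F -> y \in F -> lt x.1 y.1 -> x.1 = d ->
    y.2 \in row_positions T d -> x.2 \in row_positions F d /\ y.2 \in R.
  case: x y => [i u] [k v] /= iuF kvF ltik id vT; subst i; split; first by rewrite inE.
  have [_ vA noF] := valid_rowP (validF k) kvF.
  rewrite in_setD mem_row_positions noF //= inE vT vA /=.
  apply/existsPn => l; apply/negP => /andP[ltld]; apply/negP.
  by apply: noF; apply: row_prec_trans ltik.
(* A column of [R] is outside [A], hence nonempty; its 1 is neither in row [d] nor earlier, so it
   comes later. *)
have of_R v : v \in R -> exists2 k, (k, v) \in F & lt d k.
  rewrite in_setD mem_row_positions inE => /and4P[dvF _ vA /existsPn noF].
  have : v \in snd @: F.
    rewrite -col_cells_neq0; move: FN; rewrite inE => /and4P[_ _ _ /eqP FA].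
    by move: vA; rewrite -FA inE.
  case/imsetP => -[k l] klF /= vl; subst l; exists k => //.
  have := noF k; rewrite klF andbT => nkd.
  have /(row_prec_total T) : k != d by apply: contraNneq dvF => <-.
  by rewrite (negPf nkd).
have R_T v : v \in R -> v \in row_positions T d.
  by rewrite in_setD mem_row_positions inE => /and4P[].
(* Here [b] agrees with [up d] exactly when the cell in row [d] is the right-hand cell of the
   pair. *)
case: (boolP (b == up d)) => bup.
  have -> : (if b then row_ascents F d else row_descents F d)
            = crossings R (row_positions F d).
    by rewrite /row_ascents /row_descents (eqP bup); case: (up d).
  apply: (card_pairs_crossings injF) => [x y|v u vR].
    rewrite in_set => /andP[]; rewrite in_set /=.
    move=> /and5P[xF yF xy2 /andP[xy1 /eqP yx1] rect] /eqP.
    rewrite /least_row /=; case: ifP => [ltxy xd|nltxy yd].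
      have := row_prec_position moonT ltxy; rewrite xd -(eqP bup) -yx1 -xd.
      by case: ltngtP => // /val_inj/eqP; rewrite (negPf xy1).
    have ltyx : lt y.1 x.1 by have := row_prec_total T xy1; rewrite nltxy.
    have xT : x.2 \in row_positions T d.
      by rewrite -yd -(rectangle_subset moonT) ?FT // rectangleC.
    by have [] := in_R y x yF xF ltyx yd xT.
  rewrite mem_row_positions => duF vu; have [k kvF ltdk] := of_R v vR.
  exists (k, v), (d, u); split => //; rewrite !inE kvF duF vu /=.
  have kd : k != d by apply: contraTneq ltdk => ->; rewrite row_prec_irr.
  rewrite kd (row_prec_position moonT ltdk) (eqP bup) eqxx rectangleC.
  rewrite (rectangle_subset moonT) ?FT //= R_T //= /least_row /=.
  case: ifP => // ltkd; have := row_prec_trans ltkd ltdk.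
  by rewrite row_prec_irr.
have -> : (if b then row_ascents F d else row_descents F d)
            = crossings (row_positions F d) R.
  by rewrite /row_ascents /row_descents; case: b (up d) bup => -[].
apply: (card_pairs_crossings injF) => [x y|u v].
  rewrite in_set => /andP[]; rewrite in_set /=.
  move=> /and5P[xF yF xy2 /andP[xy1 /eqP yx1] rect] /eqP.
  rewrite /least_row /=; case: ifP => [ltxy xd|nltxy yd].
    split=> //; apply: in_R => //.
    by rewrite -xd -(rectangle_subset moonT) ?FT.
  have ltyx : lt y.1 x.1 by have := row_prec_total T xy1; rewrite nltxy.
  have := row_prec_position moonT ltyx; rewrite yx1 yd => bd.
  by rewrite bd eqxx in bup.
rewrite mem_row_positions => duF vR uv; have [k kvF ltdk] := of_R v vR.
exists (d, u), (k, v); split => //; rewrite !inE kvF duF uv /=.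
have kd : d != k by apply: contraTneq ltdk => ->; rewrite row_prec_irr.
rewrite kd (rectangle_subset moonT) ?FT //= R_T //= /least_row /= ltdk eqxx !andbT.
have := row_prec_position moonT ltdk.
move: bup; case: ltngtP => [||/val_inj/eqP]; rewrite ?(negPf kd) //.
  by case: b (up d) => -[].
by case: b (up d) => -[].
Qed.

Lemma ne2_by_rows F : F \in Nc T m A -> (t <= (\sum_d m d) + #|A|)%N ->
  ne2 T F = (\sum_d row_ascents F d)%N.
Proof.
move=> FN tmA; transitivity #|pairs_of true F|.
  apply: eq_card => -[x y]; rewrite !inE /=.
  by rewrite -(inj_eq val_inj) /=; case: (ltngtP y.1 x.1); rewrite /= ?andbT ?andbF.
rewrite -sum1_card (partition_big least_row xpredT) //=.
apply: eq_bigr => d _; rewrite -(card_pairs_of true d FN tmA) -sum1_card.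
by apply: eq_bigl => xy; rewrite inE.
Qed.

Lemma se2_by_rows F : F \in Nc T m A -> (t <= (\sum_d m d) + #|A|)%N ->
  se2 T F = (\sum_d row_descents F d)%N.
Proof.
move=> FN tmA; transitivity #|pairs_of false F|.
  apply: eq_card => -[x y]; rewrite !inE /=.
  by rewrite -(inj_eq val_inj) /=; case: (ltngtP y.1 x.1); rewrite /= ?andbT ?andbF.
rewrite -sum1_card (partition_big least_row xpredT) //=.
apply: eq_bigr => d _; rewrite -(card_pairs_of false d FN tmA) -sum1_card.
by apply: eq_bigl => xy; rewrite inE.
Qed.

(** * Row weights and the identity for column fillings *)

Variables (K : fieldType) (x y : K).
Hypothesis pq_int_neq0 : forall r, pq_int x y r.+1 != 0.

(** The value 0 on invalid rows lets the sum run over all sets of cells. *)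
Definition row_weight d F : K :=
  if valid_row F d then x ^+ row_ascents F d * y ^+ row_descents F d else 0.

Lemma row_weight_local d F F' :
  (forall z, (z.1 == d) || lt z.1 d -> (z \in F) = (z \in F')) ->
  row_weight d F = row_weight d F'.
Proof.
move=> FF'; rewrite /row_weight /valid_row /row_ascents /row_descents.
have -> : row_positions F d = row_positions F' d.
  by apply/setP => j; rewrite !inE FF' //= eqxx.
have -> // : available F d = available F' d.
apply/setP => j; rewrite !inE; congr (_ && (_ && ~~ _)).
by apply: eq_existsb => k; case ltkd: (lt k d) => //=; rewrite FF' //= ltkd orbT.
Qed.

Lemma sum_row_weight d F : (forall z, z \in F -> lt z.1 d) ->
  (forall k, lt k d -> row_weight k F != 0) ->
  \sum_S row_weight d (add_row d S F) = pq_binom x y (h T m A d) (m d)%:Z.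
Proof.
move=> Flt wF; rewrite -(@card_available F) //; last first.
  by move=> k /wF; rewrite /row_weight; case: ifP => //; rewrite eqxx.
have posS S : row_positions (add_row d S F) d = S.
  apply/setP => j; rewrite !inE eqxx /=; case djF: (_ \in F) => //.
  by have := Flt _ djF; rewrite row_prec_irr.
have availS S : available (add_row d S F) d = available F d.
  apply/setP => j; rewrite !inE; congr (_ && (_ && ~~ _)).
  apply: eq_existsb => k; case ltkd: (lt k d) => //=; rewrite !inE /=.
  by case: eqVneq => [kd|]; rewrite ?orbF //; rewrite kd row_prec_irr in ltkd.
(* In the lower half the exponents of [x] and [y] are exchanged, which the symmetry of the binomial
   absorbs. *)
case: (boolP (up d)) => upd; [rewrite -sum_crossings //|rewrite pq_binomC -sum_crossings].
- rewrite [RHS]big_mkcond; apply: eq_bigr => S _.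
  by rewrite /row_weight /valid_row /row_ascents /row_descents upd posS availS.
- rewrite [RHS]big_mkcond; apply: eq_bigr => S _.
  rewrite /row_weight /valid_row /row_ascents /row_descents (negPf upd) posS availS.
  by rewrite mulrC.
by move=> r; rewrite pq_intC.
Qed.

Lemma sum_Nc : (t <= (\sum_d m d) + #|A|)%N ->
  \sum_(F in Nc T m A) x ^+ ne2 T F * y ^+ se2 T F
  = \prod_d pq_binom x y (h T m A d) (m d)%:Z.
Proof.
move=> tmA; rewrite -(sum_by_rows (row_prec_irr T) (@row_prec_trans _ _ T)
  (row_prec_total T) row_weight_local sum_row_weight) big_mkcond.
apply: eq_bigr => F _; case: ifP => [FN|].
  rewrite (ne2_by_rows FN tmA) (se2_by_rows FN tmA) -!prodrXr -big_split /=.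
  apply: eq_bigr => d _; rewrite /row_weight ifT //.
  by move: FN; rewrite mem_Nc // => /forallP.
rewrite mem_Nc // => /negbT; rewrite negb_forall => /existsP[d ndF].
by rewrite (bigD1 d) //= /row_weight (negPf ndF) mul0r.
Qed.

End ColumnFillings.

(** * Reflection in the main diagonal, exchanging rows and columns *)

Section Transpose.

Variables s t : nat.
Implicit Types F T : {set 'I_s * 'I_t}.

Definition swap_pair (I J : Type) (x : I * J) : J * I := (x.2, x.1).
Definition transpose F : {set 'I_t * 'I_s} := [set x | (x.2, x.1) \in F].

Lemma mem_transpose F i j : ((j, i) \in transpose F) = ((i, j) \in F).
Proof. by rewrite inE. Qed.

End Transpose.

Lemma transposeK s t : cancel (@transpose s t) (@transpose t s).
Proof. by move=> F; apply/setP => -[i j]; rewrite !mem_transpose. Qed.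

Section TransposeTheory.

Variables s t : nat.
Implicit Types F T : {set 'I_s * 'I_t}.

Lemma row_positions_transpose F j : row_positions (transpose F) j = col_positions F j.
Proof. by apply/setP => i; rewrite !inE. Qed.

Lemma col_positions_transpose F i : col_positions (transpose F) i = row_positions F i.
Proof. by apply/setP => j; rewrite !inE. Qed.

Lemma row_cells_transpose F j : row_cells (transpose F) j = transpose (col_cells F j).
Proof. by apply/setP => -[k i]; rewrite !inE. Qed.

Lemma col_cells_transpose F i : col_cells (transpose F) i = transpose (row_cells F i).
Proof. by apply/setP => -[k j]; rewrite !inE. Qed.

Lemma card_transpose F : #|transpose F| = #|F|.
Proof.
rewrite -(card_imset F (f := @swap_pair 'I_s 'I_t)) => [|[a b] [c d] [-> ->]//].
apply: eq_card => -[j i]; rewrite mem_transpose; apply/idP/imsetP => [ijF|].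
  by exists (i, j).
by move=> [[k l] klF [-> ->]].
Qed.

Lemma transpose_eq0 F : (transpose F == set0) = (F == set0).
Proof. by rewrite -!cards_eq0 card_transpose. Qed.

Lemma transposeI F G : transpose (F :&: G) = transpose F :&: transpose G.
Proof. by apply/setP => -[j i]; rewrite !inE. Qed.

Lemma transpose_subset F G : (transpose F \subset transpose G) = (F \subset G).
Proof.
by apply/subsetP/subsetP => FG [i j]; have := FG (j, i); rewrite !mem_transpose.
Qed.

Lemma moon_transpose T : moon_polyomino T -> moon_polyomino (transpose T).
Proof.
case=> [[rows cols] [convr convc] [chainr chainc]]; split; split.
- by move=> j; rewrite row_cells_transpose transpose_eq0.
- by move=> i; rewrite col_cells_transpose transpose_eq0.
- by move=> j i1 i i2 hi; rewrite !mem_transpose; apply: convc.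
- by move=> i j1 j j2 hj; rewrite !mem_transpose; apply: convr.
- by move=> j1 j2; rewrite !row_positions_transpose.
- by move=> i1 i2; rewrite !col_positions_transpose.
Qed.

Lemma row_len_transpose T j : row_len (transpose T) j = col_len T j.
Proof. by rewrite /row_len row_cells_transpose card_transpose. Qed.

Lemma row_peak_transpose T : row_peak (transpose T) = col_peak T.
Proof.
rewrite /row_peak /col_peak; apply: eq_bigl => j; rewrite row_len_transpose.
by congr (_ == _); apply: eq_bigr => k _; rewrite row_len_transpose.
Qed.

Lemma row_prec_transpose T i j : row_prec (transpose T) i j = col_prec T i j.
Proof. by rewrite /row_prec /col_prec !row_len_transpose !inE row_peak_transpose. Qed.

Lemma h_transpose T n B d : h (transpose T) n B d = h' T n B d.
Proof.
rewrite /h /h' row_len_transpose; congr (_ - _ - _).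
  by congr (Posz _); apply: eq_bigl => k; rewrite row_prec_transpose.
congr (Posz _); apply: eq_card => k; rewrite !inE.
by rewrite col_cells_transpose row_cells_transpose -transposeI transpose_eq0.
Qed.

Lemma rectangle_transpose (x y : 'I_s * 'I_t) :
  rectangle (swap_pair x) (swap_pair y) = transpose (rectangle x y).
Proof. by apply/setP => -[j i]; rewrite !inE /= andbC. Qed.

Lemma transpose_Nc T n B F : (transpose F \in Nc (transpose T) n B) = (F \in Nr T n B).
Proof.
rewrite !inE /filling transpose_subset; congr [&& _, _, _ & _].
- by apply: eq_forallb => i; rewrite col_cells_transpose card_transpose.
- by apply: eq_forallb => j; rewrite row_cells_transpose card_transpose.
congr (_ == _); apply/setP => i.
by rewrite !inE col_cells_transpose transpose_eq0.
Qed.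

(* The lower left cell of an ascent becomes its upper right one. *)
Lemma ne2_transpose T F : ne2 (transpose T) (transpose F) = ne2 T F.
Proof.
pose f (xy : ('I_s * 'I_t) * ('I_s * 'I_t)) := (swap_pair xy.2, swap_pair xy.1).
rewrite /ne2 -(card_imset (ascents T F) (f := f)); last first.
  by move=> [[a b] [c d]] [[a' b'] [c' d']] [-> -> -> ->].
apply: eq_card => -[[j1 i1] [j2 i2]]; rewrite inE /= !mem_transpose.
have -> : ((j1, i1), (j2, i2)) = f ((i2, j2), (i1, j1)) by [].
rewrite mem_imset; last by move=> [[a b] [c d]] [[a' b'] [c' d']] [-> -> -> ->].
rewrite !inE /= -[(j1, i1)]/(swap_pair (i1, j1)) -[(j2, i2)]/(swap_pair (i2, j2)).
rewrite rectangle_transpose transpose_subset rectangleC.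
by case: (_ \in F); case: (_ \in F); case: ltnP; case: ltnP.
Qed.

(** Both coordinates increase along a descent, so the reflection keeps the order of its two
    cells. *)
Lemma se2_transpose T F : se2 (transpose T) (transpose F) = se2 T F.
Proof.
pose f (xy : ('I_s * 'I_t) * ('I_s * 'I_t)) := (swap_pair xy.1, swap_pair xy.2).
have injf : injective f by move=> [[a b] [c d]] [[a' b'] [c' d']] [-> -> -> ->].
rewrite /se2 -(card_imset (descents T F) injf).
apply: eq_card => -[[j1 i1] [j2 i2]]; rewrite inE /= !mem_transpose.
have -> : ((j1, i1), (j2, i2)) = f ((i1, j1), (i2, j2)) by [].
rewrite mem_imset // !inE /= -[(j1, i1)]/(swap_pair (i1, j1)).
rewrite -[(j2, i2)]/(swap_pair (i2, j2)) rectangle_transpose transpose_subset.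
by case: (_ \in F); case: (_ \in F); case: ltnP; case: ltnP.
Qed.

End TransposeTheory.

(** * The two identities for indeterminates p and q *)

(* The polynomial [r] in p, q takes the value r at p = q = 1. *)
Lemma pq_int_neq0 r : pq_int p q r.+1 != 0.
Proof.
pose P : {mpoly int[2]} := \sum_(i < r.+1) 'X_0 ^+ (r.+1 - 1 - i) * 'X_1 ^+ i.
have -> : pq_int p q r.+1 = tofrac P.
  by rewrite rmorph_sum; apply: eq_bigr => i _; rewrite rmorphM !rmorphXn.
rewrite tofrac_eq0; apply/eqP => /(congr1 (meval (fun _ => 1))).
rewrite rmorph0 rmorph_sum /= (eq_bigr (fun _ => 1)).
  by rewrite sumr_const card_ord => /eqP; rewrite pnatr_eq0.
by move=> i _; rewrite rmorphM !rmorphXn /= !mevalXU !expr1n mulr1.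
Qed.

Theorem theorem2p2 (s t : nat) (T : {set 'I_s * 'I_t})
    (m : 'I_s -> nat) (n : 'I_t -> nat) (A : {set 'I_t}) (B : {set 'I_s}) :
  moon_polyomino T ->
  ((t <= (\sum_(d < s) m d) + #|A|)%N ->
     \sum_(F in Nc T m A) p ^+ ne2 T F * q ^+ se2 T F
     = \prod_(d < s) pq_binom p q (h T m A d) (m d)%:Z) /\
  ((s <= (\sum_(d < t) n d) + #|B|)%N ->
     \sum_(F in Nr T n B) p ^+ ne2 T F * q ^+ se2 T F
     = \prod_(d < t) pq_binom p q (h' T n B d) (n d)%:Z).
Proof.
move=> moonT; split=> [tmA|snB]; first exact: sum_Nc pq_int_neq0 tmA.
rewrite (eq_bigr (fun d => pq_binom p q (h (transpose T) n B d) (n d)%:Z)); last first.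
  by move=> d _; rewrite h_transpose.
rewrite -(sum_Nc (moon_transpose moonT) pq_int_neq0 snB).
rewrite [RHS](reindex_onto (@transpose s t) (@transpose t s)) => [|F _]; last first.
  by rewrite transposeK.
apply: eq_big => [F|F _]; first by rewrite transpose_Nc transposeK eqxx andbT.
by rewrite ne2_transpose se2_transpose.
Qed.
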